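(* Let $(\mathcal{M},g)$ be a Riemannian manifold with ends of the type described in the context, of dimension $n$, and let $\theta\in C_0^\infty(\mathbb{R})$ be such that $\theta\equiv 1$ near $0$. Let $s\in(0,n/2)$ and set $$p=\frac{2n}{n-2s},\qquad \sigma=\frac{n}{2}-s>0.$$ Then there exists a constant $C_p$ such that $$\|u\|_{L^p}\leq C_p\,\|u\|_{\widetilde{B}^{-\sigma}}^{1-\frac{2}{p}}\,\|u\|_{H^s}^{\frac{2}{p}}$$ for all $u\in L^2=L^2(\mathcal{M},d\mathrm{vol}_g)$ such that the right-hand side is finite.
   Context: Manifolds with ends. $(\mathcal{M},g)$ is a smooth Riemannian manifold without boundary which is diffeomorphic, outside a compact subset, to a product $(R,\infty)\times\Gamma$ for some $R>0$ and some compact manifold without boundary $\Gamma$, such that on coordinate patches of the form $(R,\infty)\times U$, with $U$ a coordinate patch on $\Gamma$ with coordinates $y$, the metric reads $$g=G\big(r,y,dr,w(r)^{-1}dy\big),$$ where $G(r,y,v_1,v')$ is a uniformly elliptic polynomial of degree $2$ (quadratic form) in $(v_1,v')$, with coefficients bounded, as well as all their derivatives, with respect to $(r,y)$. The function $w$ is smooth and satisfies, for all $r,r'>R$ and all integers $k\geq 0$, $$0<w(r)\leq C,\qquad \frac{w(r)}{w(r')}\leq C\ \text{ if } |r-r'|\leq 1,\qquad |\partial_r^k w(r)|\leq C_k w(r).$$ Notation. $\Delta_g$ is the (nonpositive, selfadjoint on $L^2$) Laplace-Beltrami operator, $A=(-\Delta_g)^{1/2}$, and $L^p=L^p(\mathcal{M},d\mathrm{vol}_g)$.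 Functions of $\Delta_g$ and $A$ are defined by the spectral theorem. For $s\in\mathbb{R}$, $\|u\|_{H^s}=\|(1-\Delta_g)^{s/2}u\|_{L^2}=\|(1+A^2)^{s/2}u\|_{L^2}$. $C_0^\infty(\mathbb{R})$ denotes smooth compactly supported functions. Given $\theta\in C_0^\infty(\mathbb{R})$ with $\theta\equiv 1$ near $0$ and $\sigma\geq 0$, $$\|u\|_{\widetilde{B}^{-\sigma}}:=\max\Big(\sup_{k\geq 0}2^{-k\sigma}\|\theta(2^{-k}A)u\|_{L^\infty},\ \|u\|_{H^{-\sigma}}\Big),$$ with $k$ ranging over integers. *)

(* Defs.v *)
(* MathComp / MathComp-Analysis; complex numbers from mathcomp-real-closed. *)
From HB Require Import structures.
From mathcomp Require Import all_boot all_order all_algebra.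
From mathcomp Require Import all_classical all_reals all_analysis.
From mathcomp Require Import complex.

Set Implicit Arguments.
Unset Strict Implicit.
Unset Printing Implicit Defensive.

Import Order.TTheory GRing.Theory Num.Theory.
Import numFieldNormedType.Exports.

Local Open Scope classical_set_scope.
Local Open Scope ring_scope.
Local Open Scope complex_scope.

Section EuclideanCalculus.
Context {R : realType}.

Definition evec n (i : 'I_n) : 'rV[R]_n := delta_mx 0 i.

(* The iterated partial derivative of f along the directions listed in l. *)
Definition partials n (l : seq 'I_n) (f : 'rV[R]_n -> R) : 'rV[R]_n -> R :=
  foldr (fun i h x => 'D_(evec i) h x) f l.

(* C^oo on O. It is only used with O open, where it depends on f through its
   values on O alone. *)
Definition smooth_on n (O : set 'rV[R]_n) (f : 'rV[R]_n -> R) : Prop :=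
  forall (l : seq 'I_n) x, O x ->
    {for x, continuous (partials l f)} /\
    forall i, derivable (partials l f) x (evec i).

Definition smooth_map_on n k (O : set 'rV[R]_n) (f : 'rV[R]_n -> 'rV[R]_k) :=
  forall j, smooth_on O (fun x => f x 0 j).

Definition bounded_derivatives_on n (O : set 'rV[R]_n) (f : 'rV[R]_n -> R) :=
  forall l : seq 'I_n, exists C : R, forall x, O x -> `|partials l f x| <= C.

Definition smooth_on_line (D : set R) (f : R -> R) : Prop :=
  forall (k : nat) t, D t -> derivable (derive1n k f) t 1.

(* C_0^oo of the real line, with complex values. *)
Definition compact_smooth_line (f : R -> R[i]) : Prop :=
  [/\ smooth_on_line setT (fun t => complex.Re (f t)),
      smooth_on_line setT (fun t => complex.Im (f t)) &
      compact (closure [set t | f t != 0])].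

(* The Lebesgue integral over R^n of a nonnegative Borel function, as an
   iterated integral (Tonelli). *)
Fixpoint lebesgue_integral_rV n : ('rV[R]_n -> \bar R) -> \bar R :=
  match n return ('rV[R]_n -> \bar R) -> \bar R with
  | 0%N => fun f => f 0
  | k.+1 => fun f => (\int[lebesgue_measure]_t
      lebesgue_integral_rV (fun y : 'rV[R]_k => f (row_mx (t : R)%:M y)))%E
  end.

Definition quadratic_form n (A : 'M[R]_n) (v : 'rV[R]_n) : R :=
  (v *m A *m v^T) 0 0.

End EuclideanCalculus.

Section Manifolds.
Context {R : realType}.

(* cmap is meaningful on cdom only, cinv on the image of cdom only. *)
Record pchart (T : topologicalType) (n : nat) := PChart {
  cdom : set T;
  cmap : T -> 'rV[R]_n;
  cinv : 'rV[R]_n -> T }.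

Definition cimg (T : topologicalType) n (c : pchart T n) : set 'rV[R]_n :=
  cmap c @` cdom c.

Definition is_chart (T : topologicalType) n (c : pchart T n) : Prop :=
  [/\ open (cdom c), open (cimg c),
      forall q, cdom c q -> cinv c (cmap c q) = q,
      forall q, cdom c q -> {for q, continuous (cmap c)} &
      forall x, cimg c x -> {for x, continuous (cinv c)}].

Definition smooth_transition (T : topologicalType) n (c c' : pchart T n) :=
  smooth_map_on (cimg c `&` cinv c @^-1` cdom c') (cmap c' \o cinv c).

Definition compatible (T : topologicalType) n (c c' : pchart T n) : Prop :=
  smooth_transition c c' /\ smooth_transition c' c.

(* Smooth n-manifolds without boundary. The atlas is indexed by the points of
   the manifold: chart_at M q is a chart around q, whose coordinates at q also
   serve to identify the tangent space at q with R^n. *)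
Record manifold (T : topologicalType) (n : nat) := Manifold {
  chart_at : T -> pchart T n;
  chart_at_is_chart : forall q, is_chart (chart_at q);
  mem_chart_at : forall q, cdom (chart_at q) q;
  chart_at_compatible : forall q q', compatible (chart_at q) (chart_at q');
  manifold_hausdorff : hausdorff_space T;
  manifold_second_countable : @second_countable T }.

Definition smooth_function (T : topologicalType) n (M : manifold T n)
    (phi : T -> R) : Prop :=
  forall q, smooth_on (cimg (chart_at M q)) (phi \o cinv (chart_at M q)).

(* C_0^oo(M), with real values. *)
Definition test_function (T : topologicalType) n (M : manifold T n)
    (phi : T -> R) : Prop :=
  smooth_function M phi /\ compact (closure [set q | phi q != 0]).

(* g q is the matrix of the metric at q in the coordinates of chart_at M q;
   metric_in M g c x is its matrix at the point of coordinates x in the chart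
   c. Vectors are rows, so v |-> v *m J is the differential of the change of
   coordinates. *)
Definition metric_in (T : topologicalType) n (M : manifold T n)
    (g : T -> 'M[R]_n) (c : pchart T n) (x : 'rV[R]_n) : 'M[R]_n :=
  let J := jacobian (cmap (chart_at M (cinv c x)) \o cinv c) x in
  J *m g (cinv c x) *m J^T.

Definition riemannian_metric (T : topologicalType) n (M : manifold T n)
    (g : T -> 'M[R]_n) : Prop :=
  [/\ forall q, (g q)^T = g q,
      forall q v, v != 0 -> 0 < quadratic_form (g q) v &
      forall q a b, smooth_on (cimg (chart_at M q))
                      (fun x => metric_in M g (chart_at M q) x a b)].

Definition volume_density (T : topologicalType) n (M : manifold T n)
    (g : T -> 'M[R]_n) (c : pchart T n) (x : 'rV[R]_n) : R :=
  Num.sqrt (\det (metric_in M g c x)).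

(* Delta_g phi =
     |g|^{-1/2} \sum_{a,b} d_a (|g|^{1/2} g^{ab} d_b phi)
   in the coordinates of chart_at M q. *)
Definition laplace_beltrami (T : topologicalType) n (M : manifold T n)
    (g : T -> 'M[R]_n) (phi : T -> R) (q : T) : R :=
  let c := chart_at M q in
  let rho := volume_density M g c in
  let flux a x := rho x * \sum_b invmx (metric_in M g c x) a b *
                                 'D_(evec b) (phi \o cinv c) x in
  (rho (cmap c q))^-1 * \sum_a 'D_(evec a) (flux a) (cmap c q).

(* T with its Borel sigma-algebra. *)
Definition borel (T : ptopologicalType) := g_sigma_algebraType (@open T).

(* vol is the Riemannian measure of g. *)
Definition riemannian_volume (T : ptopologicalType) n (M : manifold T n)
    (g : T -> 'M[R]_n) (vol : {measure set (borel T) -> \bar R}) : Prop :=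
  forall (q : T) (A : set (borel T)),
    let c := chart_at M q in
    measurable A -> A `<=` cdom c ->
    vol A = lebesgue_integral_rV (fun x =>
      (\1_(cmap c @` A) x * volume_density M g c x)%:E).

End Manifolds.

Arguments pchart : clear implicits.
Arguments manifold : clear implicits.

Section Ends.
Context {R : realType}.

Definition weight_on (R0 : R) (w : R -> R) : Prop :=
  [/\ smooth_on_line [set r | R0 < r] w,
      exists C : R, forall r, R0 < r -> 0 < w r <= C,
      exists C : R, forall r r', R0 < r -> R0 < r' -> `|r - r'| <= 1 ->
        w r / w r' <= C &
      forall k : nat, exists C : R, forall r, R0 < r ->
        `|derive1n k w r| <= C * w r].

(* The coordinates (r, y) on the complement of K obtained from
   Phi = (r, _) : ~K -> (R0, +oo) x Gamma, of inverse Psi, and from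
   coordinates y given by a chart c of Gamma. *)
Definition end_chart (T Gamma : topologicalType) m (K : set T)
    (Phi : T -> R * Gamma) (Psi : R * Gamma -> T) (c : pchart R Gamma m) :
    pchart R T m.+1 :=
  @PChart R T m.+1
    [set q | ~ K q /\ cdom c (Phi q).2]
    (fun q => row_mx (Phi q).1%:M (cmap c (Phi q).2) : 'rV[R]_(1 + m))
    (fun x : 'rV[R]_(1 + m) => Psi (lsubmx x 0 0, cinv c (rsubmx x))).

(* Phi is a diffeomorphism of ~K onto (R0, +oo) x Gamma, of inverse Psi. *)
Definition end_diffeomorphism (T Gamma : topologicalType) m
    (M : manifold R T m.+1) (N : manifold R Gamma m) (K : set T) (R0 : R)
    (Phi : T -> R * Gamma) (Psi : R * Gamma -> T) : Prop :=
  [/\ forall q, ~ K q -> [/\ R0 < (Phi q).1, Psi (Phi q) = q &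
                            {for q, continuous Phi}],
      forall z, R0 < z.1 -> [/\ ~ K (Psi z), Phi (Psi z) = z &
                               {for z, continuous Psi}] &
      forall y q, compatible (end_chart K Phi Psi (chart_at N y))
                             (chart_at M q)].

(* g = G(r, y, dr, w(r)^{-1} dy) in the coordinates e = (r, y). The upper
   ellipticity bound is part of the boundedness of the coefficients of G. *)
Definition end_metric (T : topologicalType) m (M : manifold R T m.+1)
    (g : T -> 'M[R]_m.+1) (w : R -> R) (e : pchart R T m.+1) : Prop :=
  exists G : 'rV[R]_m.+1 -> 'M[R]_m.+1,
    [/\ forall x, cimg e x -> (G x)^T = G x,
        forall a b, smooth_on (cimg e) (fun x => G x a b) /\
                    bounded_derivatives_on (cimg e) (fun x => G x a b),
        exists2 c : R, 0 < c & forall x v, cimg e x ->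
          c * (v *m v^T) 0 0 <= quadratic_form (G x) v &
        forall (x : 'rV[R]_m.+1) (v1 : 'rV[R]_1) (v' : 'rV[R]_m), cimg e x ->
          quadratic_form (metric_in M g e x) (row_mx v1 v') =
          quadratic_form (G x) (row_mx v1 ((w (x 0 0))^-1 *: v'))].

(* The coordinate patches on Gamma are those of an atlas N of Gamma which is
   part of the data; the constants may depend on the patch (finitely many of
   them cover the compact manifold Gamma). *)
Definition has_ends (T : topologicalType) m (M : manifold R T m.+1)
    (g : T -> 'M[R]_m.+1) : Prop :=
  exists (Gamma : topologicalType) (N : manifold R Gamma m) (K : set T)
         (R0 : R) (w : R -> R) (Phi : T -> R * Gamma) (Psi : R * Gamma -> T),
    [/\ compact K, compact [set: Gamma] & 0 < R0] /\
    [/\ weight_on R0 w, end_diffeomorphism M N K R0 Phi Psi &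
        forall y, end_metric M g w (end_chart K Phi Psi (chart_at N y))].

End Ends.

Section ComplexLp.
Context {R : realType} d (X : measurableType d).
Variable mu : {measure set X -> \bar R}.

Definition cmeasurable (u : X -> R[i]) : Prop :=
  measurable_fun setT (fun x => complex.Re (u x)) /\
  measurable_fun setT (fun x => complex.Im (u x)).

Definition Lpnorm (p : \bar R) (u : X -> R[i]) : \bar R :=
  Lnorm mu p (fun x => (ComplexField.Normc.normc (u x))%:E).

Definition memL2 (u : X -> R[i]) : Prop :=
  cmeasurable u /\ (Lpnorm 2%:E u < +oo)%E.

End ComplexLp.

Section SpectralTheorem.
Context {R : realType} (T : ptopologicalType) (n : nat).
Variables (M : manifold R T n) (g : T -> 'M[R]_n).
Variable vol : {measure set (borel T) -> \bar R}.

(* The spectral theorem in multiplication operator form, for A = (-Delta_g)^{1/2}: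
   U is a unitary map of L^2(vol) onto L^2(nu), of inverse Uinv, and a >= 0 is
   measurable. The operator U^{-1} (- a^2) U, on its maximal domain, is
   selfadjoint and nonpositive, and sa_laplacian says that it extends Delta_g on
   C_0^oo(M), so that it is the selfadjoint operator Delta_g: on complete
   manifolds, Delta_g is essentially selfadjoint on C_0^oo(M). Then
   F(A) = U^{-1} F(a) U. Elements of L^2 are represented by functions, up to
   almost everywhere equality; off L^2, U and Uinv are arbitrary. *)
Record spectral_representation d (X : measurableType d)
    (nu : {measure set X -> \bar R}) := SpectralRepresentation {
  sU : (T -> R[i]) -> (X -> R[i]);
  sUinv : (X -> R[i]) -> (T -> R[i]);
  sa : X -> R;
  sU_linear : forall (k : R[i]) u v, memL2 vol u -> memL2 vol v ->
    {ae nu, forall x, sU (fun q => k * u q + v q) x = k * sU u x + sU v x};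
  sU_L2 : forall u, memL2 vol u -> memL2 nu (sU u);
  sU_isometry : forall u, memL2 vol u ->
    Lpnorm nu 2%:E (sU u) = Lpnorm vol 2%:E u;
  sUinv_L2 : forall h, memL2 nu h -> memL2 vol (sUinv h);
  sUinvK : forall h, memL2 nu h -> {ae nu, forall x, sU (sUinv h) x = h x};
  sa_measurable : measurable_fun setT sa;
  sa_ge0 : forall x, 0 <= sa x;
  sa_laplacian : forall phi, test_function M phi ->
    {ae nu, forall x, sU (fun q => (laplace_beltrami M g phi q)%:C) x =
                      - (sa x ^+ 2)%:C * sU (fun q => (phi q)%:C) x} }.

Variables (d : measure_display) (X : measurableType d).
Variables (nu : {measure set X -> \bar R}) (S : spectral_representation nu).

Definition in_domain (F : R -> R[i]) (u : T -> R[i]) : Prop :=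
  memL2 nu (fun x => F (sa S x) * sU S u x).

(* F(A) u, for u in the domain of F(A). *)
Definition functional_calculus (F : R -> R[i]) (u : T -> R[i]) : T -> R[i] :=
  sUinv S (fun x => F (sa S x) * sU S u x).

Definition sobolev_norm (s : R) (u : T -> R[i]) : \bar R :=
  let F t := ((1 + t ^+ 2) `^ (s / 2))%:C in
  if `[< in_domain F u >] then Lpnorm vol 2%:E (functional_calculus F u)
  else +oo%E.

Definition besov_norm (theta : R -> R[i]) (sigma : R) (u : T -> R[i]) : \bar R :=
  let low k := functional_calculus (fun t => theta (2 ^- k * t)) u in
  let weight (k : nat) : R := 2 `^ (- (k%:R * sigma)) in
  maxe
    (ereal_sup (range (fun k : nat => (weight k)%:E * Lpnorm vol +oo (low k))%E))
    (sobolev_norm (- sigma) u).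

End SpectralTheorem.

(* Main.v *)
(** Split u = theta(2^-k A) u + (1 - theta(2^-k A)) u. At the dyadic height
    lam_k = 2 b 2^(k sigma), where b is the Besov norm of u, the first part is
    at most lam_k / 2, so Chebyshev bounds vol {|u| > lam_k} by 4 lam_k^-2 times
    the squared L^2 norm of the second part. In the layer cake sum of |u|^p the
    resulting weight is of order b^(p-2) 2^(2 s k), and since
    1 - theta(2^-k a) = 0 unless 2^k <= a / eps, the geometric sum over k is of
    order a^(2s): this gives b^(p-2) times the squared H^s norm. The range
    |u| <= lam_0 only costs lam_0^(p-2) times the squared L^2 norm. Summing over
    dyadic heights instead of integrating over all heights avoids Tonelli, as
    the spectral measure nu need not be sigma-finite. *)
Require Import Defs.
From HB Require Import structures.
From mathcomp Require Import all_boot all_order all_algebra.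
From mathcomp Require Import all_classical all_reals all_analysis.
From mathcomp Require Import complex.
From mathcomp Require Import measurable_realfun ess_sup_inf ring lra.

Set Implicit Arguments.
Unset Strict Implicit.
Unset Printing Implicit Defensive.

Import Order.TTheory GRing.Theory Num.Theory.
Import numFieldNormedType.Exports.

Local Open Scope classical_set_scope.
Local Open Scope ring_scope.
Local Open Scope complex_scope.

(** * Geometric sums, layer cake and Chebyshev bounds *)

(** With [q = 2 ^ r], a geometric sum is at most [q / (q - 1)] times its last term, and the last
    surviving term satisfies [q ^ N = (2 ^ N) ^ r <= y ^ r]. The induction only discards vanishing
    last terms; once the last indicator is 1, all the others are bounded by 1. *)
Lemma geometric_sum_bound (R : realType) (r y : R) (N : nat) :
  0 < r ->
  \sum_(k < N) ((2 ^+ k <= y :> R)%R%:R * (2 `^ r) ^+ k) <=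
    2 `^ r / (2 `^ r - 1) * y `^ r.
Proof.
move=> r0; set q := 2 `^ r.
have q1 : 1 < q.
  have : 1 `^ r < q by rewrite gt0_ltr_powR ?nnegrE// ltr1n.
  by rewrite powR1.
have q0 : 0 < q - 1 by rewrite subr_gt0.
elim: N => [|N IH].
  by rewrite big_ord0 mulr_ge0 ?powR_ge0 ?divr_ge0 ?powR_ge0 ?ltW.
rewrite big_ord_recr /=; have [Ny|_] := leP (2 ^+ N) y; last first.
  by rewrite mul0r addr0.
apply: (@le_trans _ _ (\sum_(k < N.+1) q ^+ k)).
  rewrite big_ord_recr /= mul1r lerD2r.
  apply: ler_sum => k _; rewrite ler_piMl ?exprn_ge0 ?powR_ge0//.
  by rewrite lern1 leq_b1.
have -> : \sum_(k < N.+1) q ^+ k = (q ^+ N.+1 - 1) / (q - 1).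
  by rewrite subrX1 mulrAC mulfV ?mul1r ?gt_eqF.
rewrite mulrAC ler_pM2r ?invr_gt0//.
rewrite (@le_trans _ _ (q ^+ N.+1)) ?gerBl// exprS ler_wpM2l ?powR_ge0//.
rewrite -powR_mulrn ?powR_ge0// -powRrM mulrC powRrM powR_mulrn//.
apply: ge0_ler_powR; rewrite ?nnegrE ?exprn_ge0//; first exact: ltW.
by apply: le_trans Ny; rewrite exprn_ge0.
Qed.

Section MeasureEstimates.
Context {R : realType} d (T : measurableType d).
Variable mu : {measure set T -> \bar R}.
Implicit Types f h : T -> R.

(** Pointwise, either [f x <= lam 0], and [p - 2] factors of [f x ^ p] are replaced by [lam 0], or
    [f x] lies between two consecutive heights, and a single term of the series already dominates
    [f x ^ p]. *)
Lemma dyadic_layer_cake f (p : R) (lam : nat -> R) :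
  measurable_fun setT f -> (forall x, 0 <= f x) -> 2 <= p ->
  (forall k, 0 <= lam k) -> (forall y, exists k, y <= lam k) ->
  (\int[mu]_x (f x `^ p)%:E <=
   (lam 0%N `^ (p - 2))%:E * \int[mu]_x (f x ^+ 2)%:E +
   \sum_(0 <= k <oo) (lam k.+1 `^ p)%:E * mu [set x | (lam k < f x)%R])%E.
Proof.
move=> mf f0 p2 lam0 lamy.
have p0 : 0 < p by exact: lt_le_trans p2.
pose A k := [set x | lam k < f x].
have mA k : measurable (A k).
  by rewrite -[A k]setTI; exact: (measurable_fun_ltr _ mf).
have mA1 k : measurable_fun setT (fun x => (\1_(A k) x)%:E : \bar R).
  by apply/measurable_EFinP; exact: measurable_indic.
have mf2 : measurable_fun setT (fun x => (f x ^+ 2)%:E).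
  by apply/measurable_EFinP; exact: measurable_funX.
pose F k x := ((lam k.+1 `^ p)%:E * (\1_(A k) x)%:E : \bar R)%E.
have F0 k x : (0 <= F k x)%E by rewrite /F -EFinM lee_fin mulr_ge0 ?powR_ge0.
have mF k : measurable_fun setT (F k) by exact: measurable_funeM.
have intF k : (\int[mu]_x F k x = (lam k.+1 `^ p)%:E * mu (A k))%E.
  by rewrite ge0_integralZl_EFin ?powR_ge0 ?integral_indic ?setIT//.
(* The series of nonnegative terms is moved under the integral over [mu], so that a pointwise
   comparison suffices. *)
have -> : (\sum_(0 <= k <oo) (lam k.+1 `^ p)%:E * mu (A k) =
    \int[mu]_x \sum_(0 <= k <oo) F k x)%E.
  by rewrite integral_nneseries//; apply: eq_eseriesr => k _; rewrite intF.
rewrite -ge0_integralZl_EFin ?powR_ge0//; last first.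
  by move=> x _; rewrite lee_fin sqr_ge0.
rewrite -ge0_integralD//; first last.
- by apply: ge0_emeasurable_sum.
- by move=> x _; apply: nneseries_ge0.
- exact: measurable_funeM.
- by move=> x _; rewrite -EFinM lee_fin mulr_ge0 ?powR_ge0 ?sqr_ge0.
apply: ge0_le_integral => //.
- by move=> x _; rewrite lee_fin powR_ge0.
- by apply/measurable_EFinP; exact: (measurableT_comp (measurable_powR p)).
- by apply: emeasurable_funD; [exact: measurable_funeM|
    exact: ge0_emeasurable_sum].
move=> x _; have [fx|fx] := leP (f x) (lam 0%N).
  rewrite (@le_trans _ _ ((lam 0%N `^ (p - 2))%:E * (f x ^+ 2)%:E)%E)//;
    last first.
    by rewrite leeDl// nneseries_ge0.
  rewrite -EFinM lee_fin -powR_mulrn//.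
  have [->|fx0] := eqVneq (f x) 0.
    by rewrite powR0 ?gt_eqF// mulr_ge0 ?powR_ge0.
  have -> : f x `^ p = f x `^ (p - 2) * f x `^ 2.
    by rewrite -powRD ?subrK// fx0 implybT.
  by rewrite ler_wpM2r ?powR_ge0// ge0_ler_powR ?nnegrE ?subr_ge0.
(* The least index whose height reaches [f x] is not 0, and its predecessor is the required [k];
   monotonicity of [lam] is not assumed. *)
have [k [fk fkS]] : exists k, lam k < f x /\ f x <= lam k.+1.
  case: (ex_minnP (lamy (f x))) => -[|k]; first by rewrite leNgt fx.
  move=> fk1 kmin; exists k; split => //; rewrite ltNge; apply/negP => /kmin.
  by rewrite ltnn.
rewrite (@le_trans _ _ (F k x))//.
  rewrite /F indicE mem_set// mule1 lee_fin.
  by rewrite ge0_ler_powR ?nnegrE// ltW.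
rewrite (@le_trans _ _ (\sum_(0 <= k <oo) F k x)%E)//.
  rewrite (le_trans _ (nneseries_lim_ge k.+1 _))//.
  by rewrite big_nat_recr//= leeDr// sume_ge0.
by rewrite leeDr// -EFinM lee_fin mulr_ge0 ?powR_ge0 ?sqr_ge0.
Qed.

(** Where [f > t], the bound [c <= t / 2] leaves [h > t / 2 > 0], so the indicator of this set is at
    most [(2 * h / t) ^ 2]. *)
Lemma chebyshev_of_ae_le f h (c t : R) :
  measurable_fun setT f -> measurable_fun setT h -> 0 < t -> 2 * c <= t ->
  {ae mu, forall x, f x <= c + h x} ->
  (mu [set x | (t < f x)%R] <= (4 / t ^+ 2)%:E * \int[mu]_x (h x ^+ 2)%:E)%E.
Proof.
move=> mf mh t0 ct fch; set A := [set x | _].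
have mA : measurable A.
  by rewrite -[A]setTI; exact: (measurable_fun_ltr _ mf).
have mh2 : measurable_fun setT (fun x => (h x ^+ 2)%:E).
  by apply/measurable_EFinP; exact: measurable_funX.
have h20 x : (0 <= (h x ^+ 2)%:E)%E by rewrite lee_fin sqr_ge0.
have C0 : 0 <= 4 / t ^+ 2 :> R by rewrite divr_ge0// sqr_ge0.
rewrite -(setIT A) -integral_indic// -ge0_integralZl_EFin//.
apply: ae_ge0_le_integral => //.
- by apply/measurable_EFinP; exact: measurable_indic.
- by move=> x _; rewrite mule_ge0.
- exact: measurable_funeM.
apply: filterS fch => x fx _; rewrite -EFinM lee_fin.
have [xA|xA] := pselect (A x); last first.
  by rewrite indicE memNset// mulr_ge0// sqr_ge0.
rewrite indicE mem_set// mulrAC ler_pdivlMr ?exprn_gt0// mul1r.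
have -> : 4 * h x ^+ 2 = (2 * h x) ^+ 2 by rewrite exprMn -natrX.
rewrite ler_sqr ?nnegrE; [|exact: ltW|]; last first.
  rewrite mulr_ge0//; move: xA; rewrite /A /=; lra.
move: xA; rewrite /A /=; lra.
Qed.

Lemma measurable_indicator_ge f (c : R) : measurable_fun setT f ->
  measurable_fun setT (fun x => (c <= f x)%R%:R : R).
Proof.
move=> mf; rewrite (_ : (fun _ => _) = \1_[set x | c <= f x]); last first.
  by apply/funext => x; rewrite indicE mem_setE.
apply: measurable_indic; rewrite -[X in measurable X]setTI.
exact: (measurable_fun_ler (measurable_cst _)).
Qed.

End MeasureEstimates.

(** * The refined Sobolev estimate on abstract measure spaces *)

Lemma expr_unbounded (R : realType) (y q : R) :
  1 < q -> exists k, y <= q ^+ k.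
Proof.
move=> q1; have q0 : 0 < q - 1 by rewrite subr_gt0.
have bernoulli k : k%:R * (q - 1) <= q ^+ k.
  elim: k => [|k IH]; first by rewrite mul0r.
  have : 1 <= q ^+ k by rewrite exprn_ege1 ?ltW.
  rewrite exprS -natr1; nra.
near \oo => k; exists k; apply: le_trans (bernoulli k).
by rewrite -ler_pdivrMr//; near: k; exact: nbhs_infty_ger.
Unshelve. all: by end_near. Qed.

(** The analytic core, freed from the manifold: [f] stands for |u|, [h k] for the modulus of (1 -
    theta(2^-k A)) u, [a] for the spectral variable, [G] for the modulus of the spectral transform
    of u, and [b] for the Besov norm. [C] is chosen before the spaces and functions, hence is
    uniform in u. *)
Lemma refined_sobolev_estimate (R : realType) (p sigma s eps M : R) :
  2 < p -> 0 < sigma -> sigma * (p - 2) = 2 * s -> 0 < eps ->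
  exists2 C : R, 0 <= C &
  forall d (T : measurableType d) (mu : {measure set T -> \bar R})
    d' (X : measurableType d') (nu : {measure set X -> \bar R})
    (b : R) (f : T -> R) (h : nat -> T -> R) (a G : X -> R),
  0 < b ->
  measurable_fun setT f -> (forall x, 0 <= f x) ->
  (forall k, measurable_fun setT (h k)) ->
  measurable_fun setT a -> (forall x, 0 <= a x) -> measurable_fun setT G ->
  (forall k, {ae mu, forall x, f x <= b * (2 `^ sigma) ^+ k + h k x}) ->
  (forall k, \int[mu]_x (h k x ^+ 2)%:E <=
     \int[nu]_x (((2 ^+ k <= a x / eps)%R%:R * (M * G x)) ^+ 2)%:E)%E ->
  (\int[mu]_x (f x ^+ 2)%:E <= \int[nu]_x (G x ^+ 2)%:E)%E ->
  (\int[mu]_x (f x `^ p)%:E <= (C * b `^ (p - 2))%:E *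
     \int[nu]_x (((1 + a x ^+ 2) `^ (s / 2) * G x) ^+ 2)%:E)%E.
Proof.
move=> p2 sg0 sgs eps0.
have s0 : 0 < 2 * s by rewrite -sgs mulr_gt0// subr_gt0.
set q := 2 `^ sigma; set K := 2 `^ (2 * s) / (2 `^ (2 * s) - 1).
have q0 : 0 < q by rewrite powR_gt0.
have q1 : 1 < q.
  have : 1 `^ sigma < q by rewrite gt0_ltr_powR ?nnegrE// ltr1n.
  by rewrite powR1.
have K0 : 0 <= K.
  rewrite divr_ge0 ?powR_ge0// subr_ge0.
  have : 1 `^ (2 * s) <= 2 `^ (2 * s).
    by rewrite ge0_ler_powR ?nnegrE ?ler1n// ltW.
  by rewrite powR1.
(* The 4 comes from Chebyshev, [q ^ p] from passing from [lam k] to [lam k.+1], [M ^ 2] from the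
   size of the symbol, and the rest from the geometric sum evaluated at [a / eps]. *)
pose L := 4 * q `^ p * (M ^+ 2 * (K * eps^-1 `^ (2 * s))).
have L0 : 0 <= L.
  apply: mulr_ge0; apply: mulr_ge0; rewrite ?sqr_ge0 ?powR_ge0//.
  by rewrite mulr_ge0 ?powR_ge0.
(* The summand 1 pays for the range below [lam 0], [L] for the series; [2 ^ (p - 2)] comes from the
   factor 2 in the heights. *)
exists (2 `^ (p - 2) * (1 + L)); first by rewrite mulr_ge0 ?powR_ge0 ?addr_ge0.
move=> d T mu d' X nu b f h a G b0 mf f0 mh ma a0 mG fh hG fG.
set I := (X in (_ <= _ * X)%E).
have mw : measurable_fun setT (fun x => (1 + a x ^+ 2) `^ (s / 2)).
  apply: (measurableT_comp (measurable_powR (s / 2))).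
  by apply: measurable_funD => //; exact: measurable_funX.
have mI : measurable_fun setT
    (fun x => (((1 + a x ^+ 2) `^ (s / 2) * G x) ^+ 2)%:E).
  by apply/measurable_EFinP/measurable_funX/measurable_funM.
have I0 : (0 <= I)%E by apply: integral_ge0 => x _; rewrite lee_fin sqr_ge0.
have wE x : ((1 + a x ^+ 2) `^ (s / 2)) ^+ 2 = (1 + a x ^+ 2) `^ s.
  by rewrite -powR_mulrn ?powR_ge0// -powRrM divfK.
have s0' : 0 < s by move: s0; rewrite pmulr_rgt0.
have w1 x : 1 <= (1 + a x ^+ 2) `^ s.
  have : 1 `^ s <= (1 + a x ^+ 2) `^ s.
    by rewrite ge0_ler_powR ?nnegrE ?addr_ge0 ?lerDl ?sqr_ge0// ltW.
  by rewrite powR1.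
(* The Sobolev weight is at least 1, so the L^2 term of the layer cake is also controlled by [I]. *)
have GI : (\int[nu]_x (G x ^+ 2)%:E <= I)%E.
  apply: ge0_le_integral => //.
  - by move=> x _; rewrite lee_fin sqr_ge0.
  - by apply/measurable_EFinP/measurable_funX.
  - by move=> x _; rewrite lee_fin exprMn wE ler_peMl ?sqr_ge0.
(* Twice the bound on the low-frequency part: the condition [2 * c <= t] of the Chebyshev lemma then
   holds with equality. *)
pose lam k := 2 * b * q ^+ k.
have lam_gt0 k : 0 < lam k.
  by apply: mulr_gt0; [exact: mulr_gt0|exact: exprn_gt0].
have lamy y : exists k, y <= lam k.
  have [k yk] := expr_unbounded (y / (2 * b)) q1.
  by exists k; rewrite /lam mulrC -ler_pdivrMr// mulr_gt0.
apply: (le_trans (dyadic_layer_cake mu mf f0 (ltW p2)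
  (fun k => ltW (lam_gt0 k)) lamy)).
have -> : 2 `^ (p - 2) * (1 + L) * b `^ (p - 2) =
    lam 0%N `^ (p - 2) + (2 * b) `^ (p - 2) * L.
  by rewrite /lam expr0 mulr1 powRM ?(ltW b0)//; ring.
rewrite EFinD ge0_muleDl ?lee_fin ?powR_ge0//; last first.
  by apply: mulr_ge0 L0; exact: powR_ge0.
apply: leeD.
  by rewrite lee_wpmul2l ?lee_fin ?powR_ge0//; exact: le_trans GI.
pose H k x := ((2 ^+ k <= a x / eps)%R%:R * (M * G x)) ^+ 2.
have mH k : measurable_fun setT (fun x => (H k x)%:E).
  apply/measurable_EFinP/measurable_funX/measurable_funM; last first.
    exact: measurable_funM.
  by apply: measurable_indicator_ge; exact: measurable_funM.
have H0 k x : (0 <= (H k x)%:E :> \bar R)%E by rewrite lee_fin sqr_ge0.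
pose D := 4 * q `^ p * (2 * b) `^ (p - 2).
have D0 : 0 <= D by rewrite /D mulr_ge0 ?mulr_ge0 ?powR_ge0.
pose Q := 2 `^ (2 * s).
have Q0 : 0 <= Q by exact: powR_ge0.
have mQH k : measurable_fun setT (fun x => (Q ^+ k * H k x)%:E).
  by under eq_fun do rewrite EFinM; exact: measurable_funeM.
have QH0 k x : (0 <= (Q ^+ k * H k x)%:E :> \bar R)%E.
  by rewrite lee_fin; apply: mulr_ge0; [exact: exprn_ge0|exact: sqr_ge0].
(* Here [lam k.+1 ^ p / lam k ^ 2 = q ^ p * lam k ^ (p - 2)], and [sigma * (p - 2) = 2 * s] turns
   the growth [q ^ (k * (p - 2))] into [Q ^ k]. *)
have term_le k : ((lam k.+1 `^ p)%:E * mu [set x | (lam k < f x)%R] <=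
    D%:E * \int[nu]_x (Q ^+ k * H k x)%:E)%E.
  have := chebyshev_of_ae_le mf (mh k) (lam_gt0 k) _ (fh k).
  rewrite {1}/lam mulrA => /(_ (lexx _)) muk.
  under eq_integral do rewrite EFinM.
  rewrite ge0_integralZl_EFin ?exprn_ge0// muleA -EFinM.
  apply: (le_trans (lee_wpmul2l _ muk)); first by rewrite lee_fin powR_ge0.
  rewrite muleA -EFinM (_ : _ * (4 / _) = D * Q ^+ k).
    by rewrite lee_wpmul2l// lee_fin mulr_ge0 ?exprn_ge0.
  have lamS : lam k.+1 = q * lam k by rewrite /lam exprS; ring.
  rewrite lamS powRM ?(ltW q0) ?(ltW (lam_gt0 k))//.
  have -> : lam k `^ p = lam k `^ (p - 2) * lam k ^+ 2.
    rewrite -powR_mulrn ?(ltW (lam_gt0 k))// -powRD ?subrK//.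
    by rewrite (gt_eqF (lam_gt0 k)) implybT.
  have QE : Q ^+ k = (q ^+ k) `^ (p - 2).
    have q0' := ltW q0.
    rewrite -(powR_mulrn k Q0) -(powR_mulrn k q0') /Q /q -!powRrM -sgs.
    by congr (_ `^ _); ring.
  rewrite QE.
  rewrite {1}/lam powRM ?exprn_ge0 ?mulr_ge0 ?(ltW q0) ?(ltW b0)// /D.
  by field; rewrite gt_eqF.
(* It is enough to bound each partial sum independently of [N]; a finite sum passes under the
   integral over [nu] for any measure. *)
apply: lime_le.
  by apply: is_cvg_nneseries => k _ _; rewrite mule_ge0 ?lee_fin ?powR_ge0.
apply: nearW => N.
apply: (@le_trans _ _
  (\sum_(0 <= k < N) D%:E * \int[nu]_x (Q ^+ k * H k x)%:E)%E).
  exact: lee_sum.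
rewrite -ge0_sume_distrr; last by move=> k _; exact: integral_ge0.
rewrite -ge0_integral_sum//.
have -> : (2 * b) `^ (p - 2) * L =
    D * (K * eps^-1 `^ (2 * s) * M ^+ 2) by rewrite /D /L; ring.
rewrite [(D * _)%:E]EFinM -muleA lee_wpmul2l ?lee_fin//.
rewrite -ge0_integralZl_EFin//; last 2 first.
- by move=> x _; rewrite lee_fin sqr_ge0.
- by apply: mulr_ge0 (sqr_ge0 M); apply: mulr_ge0 K0 (powR_ge0 _ _).
apply: ge0_le_integral => //.
- by move=> x _; exact: sume_ge0.
- exact: emeasurable_sum.
- exact: measurable_funeM.
move=> x _; rewrite sumEFin -EFinM lee_fin exprMn wE.
(* An indicator equals its square, so the factor independent of [k] comes out and leaves the sum of
   [geometric_sum_bound]. *)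
rewrite (_ : \sum_(_ <= _ < _) _ = (M * G x) ^+ 2 *
    \sum_(k < N) ((2 ^+ k <= a x / eps)%R%:R * Q ^+ k)); last first.
  rewrite big_mkord mulr_sumr; apply: eq_bigr => k _; rewrite /H exprMn.
  by case: (_ <= _); rewrite ?expr1n ?expr0n /=; ring.
rewrite (_ : K * _ * _ * _ = (M * G x) ^+ 2 *
  (K * ((1 + a x ^+ 2) `^ s * eps^-1 `^ (2 * s))));
  last by rewrite exprMn; ring.
rewrite ler_wpM2l ?sqr_ge0//; apply: le_trans (geometric_sum_bound _ _ s0) _.
(* What remains is [a ^ (2 * s) = (a ^ 2) ^ s <= (1 + a ^ 2) ^ s]. *)
rewrite ler_wpM2l// powRM ?invr_ge0 ?(ltW eps0)// ler_wpM2r ?powR_ge0//.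
rewrite powRrM powR_mulrn// ge0_ler_powR ?nnegrE ?addr_ge0 ?sqr_ge0 ?ltW//.
by rewrite ltrDr.
Qed.

(** * Modulus, measurability and L^p norms of complex functions *)

Section ComplexModulus.
Context {R : realType}.
Implicit Types z w : R[i].
Local Notation normc := ComplexField.Normc.normc.

Lemma normc_ge0 z : 0 <= normc z.
Proof. by case: z => x y; rewrite /= sqrtr_ge0. Qed.

Lemma normcD_le z w : normc (z + w) <= normc z + normc w.
Proof. exact: le_normcD. Qed.

Lemma normc_opp z : normc (- z) = normc z.
Proof. exact: normcN. Qed.

End ComplexModulus.

Section ComplexLpFacts.
Context {R : realType} d (T : measurableType d).
Variable mu : {measure set T -> \bar R}.
Implicit Types u v : T -> R[i].
Local Notation normc := ComplexField.Normc.normc.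

Lemma measurable_normc u :
  cmeasurable u -> measurable_fun setT (fun x => normc (u x)).
Proof.
move=> [mr mi]; rewrite (_ : (fun x => _) =
  Num.sqrt \o (fun x => complex.Re (u x) ^+ 2 + complex.Im (u x) ^+ 2)).
  apply: measurableT_comp.
    by apply: continuous_measurable_fun; exact: sqrt_continuous.
  by apply: measurable_funD; exact: measurable_funX.
by apply/funext => x /=; case: (u x).
Qed.

Lemma cmeasurable_cst (z : R[i]) : cmeasurable (fun _ : T => z).
Proof.
by split; [exact: (measurable_cst (complex.Re z))|
  exact: (measurable_cst (complex.Im z))].
Qed.

Lemma cmeasurableD u v :
  cmeasurable u -> cmeasurable v -> cmeasurable (fun x => u x + v x).
Proof.
move=> [ur ui] [vr vi]; split.
- rewrite (_ : (fun x => _) = (fun x => complex.Re (u x) + complex.Re (v x))).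
    exact: measurable_funD.
  by apply/funext => x; case: (u x) => ? ?; case: (v x).
- rewrite (_ : (fun x => _) = (fun x => complex.Im (u x) + complex.Im (v x))).
    exact: measurable_funD.
  by apply/funext => x; case: (u x) => ? ?; case: (v x).
Qed.

Lemma cmeasurableM u v :
  cmeasurable u -> cmeasurable v -> cmeasurable (fun x => u x * v x).
Proof.
move=> [ur ui] [vr vi]; split.
- rewrite (_ : (fun x => _) = (fun x => complex.Re (u x) * complex.Re (v x) -
    complex.Im (u x) * complex.Im (v x))).
    by apply: measurable_funB; exact: measurable_funM.
  by apply/funext => x; case: (u x) => ? ?; case: (v x).
- rewrite (_ : (fun x => _) = (fun x => complex.Re (u x) * complex.Im (v x) +
    complex.Im (u x) * complex.Re (v x))).
    by apply: measurable_funD; exact: measurable_funM.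
  by apply/funext => x; case: (u x) => ? ?; case: (v x).
Qed.

Lemma cmeasurable_oneB u : cmeasurable u -> cmeasurable (fun x => 1 - u x).
Proof.
move=> mu_; rewrite (_ : (fun _ => _) = (fun x => 1 + -1 * u x)).
  apply: cmeasurableD; first exact: cmeasurable_cst.
  by apply: cmeasurableM => //; exact: cmeasurable_cst.
by apply/funext => x; rewrite mulN1r.
Qed.

Lemma LpnormE (p : R) u :
  Lpnorm mu p%:E u = ((\int[mu]_x (normc (u x) `^ p)%:E) `^ p^-1)%E.
Proof.
rewrite /Lpnorm hoelder.Lnorm.unlock.
by under eq_integral do
  rewrite abse_EFin (ger0_norm (normc_ge0 _)) poweR_EFin.
Qed.

Lemma Lpnorm2E u :
  Lpnorm mu 2%:E u = ((\int[mu]_x (normc (u x) ^+ 2)%:E) `^ 2^-1)%E.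
Proof.
rewrite LpnormE.
by under eq_integral do rewrite (powR_mulrn _ (normc_ge0 _)).
Qed.

Lemma integral_sqr_normc_ge0 u : (0 <= \int[mu]_x (normc (u x) ^+ 2)%:E)%E.
Proof. by apply: integral_ge0 => x _; rewrite lee_fin sqr_ge0. Qed.

Lemma Lpnorm2_sqr u :
  (Lpnorm mu 2%:E u `^ 2 = \int[mu]_x (normc (u x) ^+ 2)%:E)%E.
Proof.
by rewrite Lpnorm2E -poweRrM mulVf// poweRe1// integral_sqr_normc_ge0.
Qed.

Lemma memL2P u : memL2 mu u <->
  cmeasurable u /\ (\int[mu]_x (normc (u x) ^+ 2)%:E < +oo)%E.
Proof.
split=> -[mu_ fin]; split => //.
  by rewrite -Lpnorm2_sqr poweR_lty.
by rewrite Lpnorm2E poweR_lty.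
Qed.

Lemma measurable_sqr_normc u : cmeasurable u ->
  measurable_fun setT (fun x => (normc (u x) ^+ 2)%:E : \bar R).
Proof.
by move=> mu_; apply/measurable_EFinP/measurable_funX/measurable_normc.
Qed.

Lemma Lpnorm2_ae_eq u v : cmeasurable u -> cmeasurable v ->
  {ae mu, forall x, u x = v x} -> Lpnorm mu 2%:E u = Lpnorm mu 2%:E v.
Proof.
move=> mu_ mv uv; rewrite !Lpnorm2E; congr (_ `^ _)%E.
apply: ge0_ae_eq_integral => //; [exact: measurable_sqr_normc
 |exact: measurable_sqr_normc|..]; try by move=> x _; rewrite lee_fin sqr_ge0.
by apply: filterS uv => x -> _.
Qed.

Lemma memL2_bounded (w u : T -> R[i]) (c : R) : cmeasurable w ->
  (forall x, normc (w x) <= c) -> memL2 mu u -> memL2 mu (fun x => w x * u x).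
Proof.
move=> mw wc /memL2P[mu_ uoo]; apply/memL2P; split; first exact: cmeasurableM.
apply: (@le_lt_trans _ _ ((c ^+ 2)%:E * \int[mu]_x (normc (u x) ^+ 2)%:E)%E).
  rewrite -ge0_integralZl_EFin ?sqr_ge0//; last 2 first.
  - by move=> x _; rewrite lee_fin sqr_ge0.
  - exact: measurable_sqr_normc.
  apply: ge0_le_integral => //.
  - by move=> x _; rewrite lee_fin sqr_ge0.
  - by apply: measurable_sqr_normc; exact: cmeasurableM.
  - by apply: measurable_funeM; exact: measurable_sqr_normc.
  move=> x _; rewrite -EFinM lee_fin ComplexField.Normc.normcM exprMn.
  rewrite ler_wpM2r ?sqr_ge0// ler_sqr ?nnegrE ?normc_ge0//.
  exact: le_trans (normc_ge0 _) (wc x).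
by rewrite lte_mul_pinfty// lee_fin sqr_ge0.
Qed.

(** Follows from |v - u|^2 <= 2 |u|^2 + 2 |v|^2. The difference is written [-1 * u x + v x] to match
    the linearity field [sU_linear]. *)
Lemma memL2_sub u v : memL2 mu u -> memL2 mu v ->
  memL2 mu (fun x => -1 * u x + v x).
Proof.
move=> /memL2P[mu_ uoo] /memL2P[mv voo]; apply/memL2P.
have m : cmeasurable (fun x => -1 * u x + v x).
  apply: cmeasurableD => //; apply: cmeasurableM => //; exact: cmeasurable_cst.
split => //.
apply: (@le_lt_trans _ _ (2%:E * \int[mu]_x (normc (u x) ^+ 2)%:E +
   2%:E * \int[mu]_x (normc (v x) ^+ 2)%:E)%E).
  have u0 x : (0 <= (normc (u x) ^+ 2)%:E)%E by rewrite lee_fin sqr_ge0.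
  have v0 x : (0 <= (normc (v x) ^+ 2)%:E)%E by rewrite lee_fin sqr_ge0.
  have mu2 := measurable_sqr_normc mu_; have mv2 := measurable_sqr_normc mv.
  rewrite -!ge0_integralZl_EFin// -ge0_integralD//; first last.
  - exact: measurable_funeM.
  - by move=> x _; rewrite mule_ge0.
  - exact: measurable_funeM.
  - by move=> x _; rewrite mule_ge0.
  apply: ge0_le_integral => //.
  - by move=> x _; rewrite lee_fin sqr_ge0.
  - exact: measurable_sqr_normc.
  - by apply: emeasurable_funD; exact: measurable_funeM.
  move=> x _; rewrite -!EFinM -EFinD lee_fin mulN1r.
  have := normcD_le (- u x) (v x).
  rewrite normc_opp.
  have := normc_ge0 (- u x + v x); have := normc_ge0 (u x).
  have := normc_ge0 (v x).
  set B := normc _; set D := normc _; set A := normc _ => B0 D0 A0 AB.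
  have : A ^+ 2 <= (D + B) ^+ 2 by rewrite ler_sqr ?nnegrE// addr_ge0.
  have := sqr_ge0 (D - B); nra.
by rewrite lte_add_pinfty ?lte_mul_pinfty.
Qed.

Lemma Lpnormy_le_ae u (r : R) : (Lpnorm mu +oo u <= r%:E)%E ->
  {ae mu, forall x, normc (u x) <= r}.
Proof.
rewrite /Lpnorm hoelder.Lnorm.unlock; case: ifPn => [_ /ess_supP|].
  by apply: filterS => x; rewrite /= lee_fin ger0_norm ?normc_ge0.
(* The norm at [+oo] is an essential supremum only if the whole space has positive measure;
   otherwise everything holds almost everywhere. *)
rewrite -leNgt measure_le0 => /eqP mu0 _.
by exists setT; split.
Qed.

(** For the degenerate cases of the theorem: such a [u] vanishes almost everywhere. *)
Lemma Lpnorm_eq0_of_integral_sqr_eq0 (p : R) u : 0 < p -> cmeasurable u ->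
  (\int[mu]_x (normc (u x) ^+ 2)%:E = 0)%E -> Lpnorm mu p%:E u = 0%E.
Proof.
move=> p0 mu_ u0.
have u_ae0 :
    (fun x => (normc (u x) ^+ 2)%:E : \bar R) = cst 0%E %[ae mu].
  apply/ae_eq_integral_abs => //; first exact: measurable_sqr_normc.
  rewrite -[RHS]u0; apply: eq_integral => x _.
  by rewrite gee0_abs// lee_fin sqr_ge0.
have up0 : (\int[mu]_x (normc (u x) `^ p)%:E = 0)%E.
  rewrite -(integral0 mu setT); apply: ge0_ae_eq_integral => //.
  - apply/measurable_EFinP.
    exact/(measurableT_comp (measurable_powR p))/measurable_normc.
  - by move=> x _; rewrite lee_fin powR_ge0.
  - apply: filterS u_ae0 => x /(_ I)[] /eqP; rewrite sqrf_eq0 => /eqP -> _.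
    by rewrite powR0 ?gt_eqF.
by rewrite LpnormE up0 poweR0r ?gt_eqF ?invr_gt0.
Qed.

End ComplexLpFacts.

(** * Boundedness of the cutoff symbol *)

Section SymbolBounds.
Context {R : realType}.
Local Notation normc := ComplexField.Normc.normc.

Lemma smooth_on_line_continuous (f : R -> R) :
  smooth_on_line setT f -> continuous f.
Proof.
move=> sf t; apply: differentiable_continuous; apply/derivable1_diffP.
exact: (sf 0%N t I).
Qed.

Lemma continuous_compact_bound (f : R -> R) (K : set R) :
  continuous f -> compact K -> exists A, forall t, K t -> `|f t| <= A.
Proof.
move=> cf cK.
have [A [_ fA]] : bounded_set (f @` K).
  by apply/compact_bounded/continuous_compact => //;
    exact: continuous_subspaceT.
(* [bounded_set] grants the bound only for numbers strictly above [A]. *)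
exists (A + 1) => t Kt; apply: (fA (A + 1)); first by rewrite ltrDl.
by exists t.
Qed.

Lemma normc_le_ReIm (z : R[i]) :
  normc z <= `|complex.Re z| + `|complex.Im z|.
Proof.
case: z => x y /=; rewrite -ler_sqr ?nnegrE ?addr_ge0// sqr_sqrtr; last first.
  by rewrite addr_ge0 ?sqr_ge0.
rewrite sqrrD !real_normK ?num_real//.
by rewrite -addrA lerD2l lerDr mulrn_wge0// mulr_ge0.
Qed.

Lemma compact_smooth_line_bounded (theta : R -> R[i]) :
  compact_smooth_line theta -> exists A, forall t, normc (theta t) <= A.
Proof.
move=> [/smooth_on_line_continuous cr /smooth_on_line_continuous ci cK].
have [A KA] := continuous_compact_bound cr cK.
have [B KB] := continuous_compact_bound ci cK.
(* The maximum with 0 serves the points where [theta] vanishes: [A + B] is only known to bound on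
   the support, which may be empty. *)
exists (Num.max 0 (A + B)) => t; rewrite le_max.
have [->|t0] := eqVneq (theta t) 0.
  by rewrite ComplexField.Normc.normc0 lexx.
apply/orP; right; apply: le_trans (normc_le_ReIm _) _.
have Kt : closure [set t | theta t != 0] t by exact: subset_closure.
by rewrite lerD ?KA ?KB.
Qed.

End SymbolBounds.

(** * Functional calculus and Sobolev norms on the spectral side *)

Section FunctionalCalculus.
Context {R : realType} (T : ptopologicalType) (n : nat).
Variables (M : manifold R T n) (g : T -> 'M[R]_n).
Variable vol : {measure set (borel T) -> \bar R}.
Variables (d : measure_display) (X : measurableType d).
Variable nu : {measure set X -> \bar R}.
Variable S : spectral_representation M g vol nu.
Local Notation normc := ComplexField.Normc.normc.

Lemma sU_cmeasurable u : memL2 vol u -> cmeasurable (sU S u).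
Proof. by case/(sU_L2 S). Qed.

Lemma sU_sqr_isometry u : memL2 vol u ->
  (\int[vol]_x (normc (u x) ^+ 2)%:E =
   \int[nu]_x (normc (sU S u x) ^+ 2)%:E)%E.
Proof. by move=> /(sU_isometry S) iso; rewrite -!Lpnorm2_sqr iso. Qed.

(** The isometry is given for [sU] only, so the norm of [sUinv h] is computed by applying [sU] and
    cancelling almost everywhere. *)
Lemma Lpnorm2_functional_calculus F u : in_domain S F u ->
  Lpnorm vol 2%:E (functional_calculus S F u) =
  Lpnorm nu 2%:E (fun x => F (sa S x) * sU S u x).
Proof.
move=> dF; have L2 := sUinv_L2 S dF.
rewrite -(sU_isometry S L2); apply: Lpnorm2_ae_eq (sUinvK S dF).
- exact: sU_cmeasurable.
- by case: dF.
Qed.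

Lemma sobolev_norm_ge0 s u : (0 <= sobolev_norm S s u)%E.
Proof.
by rewrite /sobolev_norm; case: ifP => // _; rewrite LpnormE poweR_ge0.
Qed.

(** Finiteness excludes the default value [+oo], which places [u] in the domain of the weight. *)
Lemma sobolev_norm_sqr s u : (sobolev_norm S s u < +oo)%E ->
  (sobolev_norm S s u `^ 2 =
   \int[nu]_x (((1 + sa S x ^+ 2) `^ (s / 2) * normc (sU S u x)) ^+ 2)%:E)%E.
Proof.
rewrite /sobolev_norm; case: ifPn => [/asboolP dF _|_]; last by rewrite ltxx.
rewrite Lpnorm2_functional_calculus// Lpnorm2_sqr.
apply: eq_integral => x _; rewrite ComplexField.Normc.normcM.
by rewrite /= expr0n/= addr0 sqrtr_sqr ger0_norm ?powR_ge0.
Qed.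

(** The weight is positive whatever the sign of [s], so [sU S u] vanishes almost everywhere and the
    isometry carries this back to [u]. *)
Lemma sobolev_norm_eq0 s u : memL2 vol u -> sobolev_norm S s u = 0%E ->
  (\int[vol]_x (normc (u x) ^+ 2)%:E = 0)%E.
Proof.
move=> L2u s0; rewrite sU_sqr_isometry//.
have mU := measurable_normc (sU_cmeasurable L2u).
have mw : measurable_fun setT (fun x =>
    (((1 + sa S x ^+ 2) `^ (s / 2) * normc (sU S u x)) ^+ 2)%:E : \bar R).
  apply/measurable_EFinP/measurable_funX/measurable_funM => //.
  apply: (measurableT_comp (measurable_powR (s / 2))).
  apply: measurable_funD => //; apply: measurable_funX.
  exact: sa_measurable.
have := @sobolev_norm_sqr s u; rewrite s0 poweR0r// => /(_ (ltry _)) w0.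
have : ae_eq nu setT (fun x => (((1 + sa S x ^+ 2) `^ (s / 2) *
    normc (sU S u x)) ^+ 2)%:E : \bar R) (cst 0%E).
  apply/ae_eq_integral_abs => //; rewrite w0; apply: eq_integral => x _.
  by rewrite gee0_abs// lee_fin sqr_ge0.
move=> wU0; rewrite -(integral0 nu setT); apply: ge0_ae_eq_integral => //.
- exact/measurable_EFinP/measurable_funX.
- by move=> x _; rewrite lee_fin sqr_ge0.
- apply: filterS wU0 => x /(_ I)[] /eqP; rewrite sqrf_eq0 mulf_eq0 => + _.
  rewrite powR_eq0 gt_eqF ?ltr_pwDl ?sqr_ge0//= => /eqP ->.
  by rewrite expr0n.
Qed.

(** Taking [v] as a difference, rather than as a function of A applied to [u], makes u = F(A) u + v
    hold at every point; linearity of [sU] then gives the multiplier 1 - F. *)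
Lemma functional_calculus_complement F c u :
  cmeasurable (fun x => F (sa S x)) -> (forall t, normc (F t) <= c) ->
  memL2 vol u ->
  let v q := -1 * functional_calculus S F u q + u q in
  memL2 vol v /\
  (\int[vol]_x (normc (v x) ^+ 2)%:E =
   \int[nu]_x ((normc (1 - F (sa S x)) * normc (sU S u x)) ^+ 2)%:E)%E.
Proof.
move=> mF Fc L2u v; have L2U := sU_L2 S L2u.
have dF : in_domain S F u by apply: memL2_bounded mF _ L2U => x; exact: Fc.
have L2F := sUinv_L2 S dF.
have L2v : memL2 vol v by exact: memL2_sub.
split => //; rewrite -Lpnorm2_sqr -(sU_isometry S L2v).
rewrite (@Lpnorm2_ae_eq _ _ _ _ _ (fun x => (1 - F (sa S x)) * sU S u x)).
- rewrite Lpnorm2_sqr; apply: eq_integral => x _.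
  by rewrite ComplexField.Normc.normcM.
- exact: sU_cmeasurable.
- apply: cmeasurableM; last by case: L2U.
  exact: cmeasurable_oneB.
- apply: filterS2 (sU_linear S (-1) L2F L2u) (sUinvK S dF) => x -> ->.
  by rewrite mulrBl mul1r mulN1r addrC.
Qed.

End FunctionalCalculus.

(** * The inequality on the manifold *)

Theorem theorem3 (R : realType) (m : nat) (T : ptopologicalType)
    (M : manifold R T m.+1) (g : T -> 'M[R]_m.+1)
    (vol : {measure set (borel T) -> \bar R})
    (d : measure_display) (X : measurableType d)
    (nu : {measure set X -> \bar R})
    (S : spectral_representation M g vol nu)
    (theta : R -> R[i]) (s : R) :
  riemannian_metric M g ->
  has_ends M g ->
  riemannian_volume M g vol ->
  compact_smooth_line theta ->
  (\forall t \near (0 : R), theta t = 1) ->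
  let n : R := m.+1%:R in
  0 < s < n / 2 ->
  let p : R := 2 * n / (n - 2 * s) in
  let sigma : R := n / 2 - s in
  exists C : R, forall u : T -> R[i],
    memL2 vol u ->
    let rhs := (besov_norm S theta sigma u `^ (1 - 2 / p) *
                sobolev_norm S s u `^ (2 / p))%E in
    (rhs < +oo)%E ->
    (Lpnorm vol p%:E u <= C%:E * rhs)%E.
Proof.
move=> _ _ _ theta_smooth theta1 n /andP[s0 sn] p sigma; clearbody n.
have ns0 : 0 < n - 2 * s by lra.
have sigma0 : 0 < sigma by rewrite /sigma; lra.
have p2 : 2 < p by rewrite /p ltr_pdivlMr//; lra.
have p0 : 0 < p by lra.
(* Since [p - 2 = 4 * s / (n - 2 * s)] and [sigma = (n - 2 * s) / 2]. *)
have sigma_p : sigma * (p - 2) = 2 * s.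
  by rewrite /sigma /p; field; rewrite gt_eqF.
have [A thetaA] := compact_smooth_line_bounded theta_smooth.
have [eps /= eps0 theta_eps] := theta1.
(* [1 + A] bounds |1 - theta|, and [eps] is a radius within which [theta] is 1. *)
have [C C0 est] := refined_sobolev_estimate (1 + A) p2 sigma0 sigma_p eps0.
exists (C `^ p^-1) => u L2u /=.
set B := besov_norm S theta sigma u; set H := sobolev_norm S s u.
set rhs := (_ `^ _ * _)%E => rhs_fin.
have H0 : (0 <= H)%E by exact: sobolev_norm_ge0.
have HB : (sobolev_norm S (- sigma) u <= B)%E by rewrite le_max lexx orbT.
have B0 : (0 <= B)%E by apply: le_trans HB; exact: sobolev_norm_ge0.
have e1 : 0 < 1 - 2 / p by rewrite subr_gt0 ltr_pdivrMr ?mul1r.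
have e2 : 0 < 2 / p by rewrite divr_gt0.
have rhs0 : (0 <= (C `^ p^-1)%:E * rhs)%E.
  by rewrite !mule_ge0 ?poweR_ge0 ?lee_fin ?powR_ge0.
have [mu _] := L2u.
(* Vanishing norms come first: with 0 times [+oo] equal to 0, a finite right-hand side could hide an
   infinite factor, and [est] requires [0 < b]. If either norm is 0, then [u] is 0 almost
   everywhere; for [B] this uses its H^(-sigma) component. *)
have [B_eq0|B_neq0] := eqVneq B 0%E.
  rewrite (Lpnorm_eq0_of_integral_sqr_eq0 p0 mu)//.
  apply: (@sobolev_norm_eq0 _ _ _ _ _ _ _ _ _ S (- sigma)) => //.
  by apply/eqP; rewrite eq_le sobolev_norm_ge0 -B_eq0 HB.
have [H_eq0|H_neq0] := eqVneq H 0%E.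
  rewrite (Lpnorm_eq0_of_integral_sqr_eq0 p0 mu)//.
  exact: (@sobolev_norm_eq0 _ _ _ _ _ _ _ _ _ S s).
have B_gt0 : (0 < B)%E by rewrite lt_def B_neq0.
have H_gt0 : (0 < H)%E by rewrite lt_def H_neq0.
have B_fin : (B < +oo)%E.
  rewrite ltey; apply: contraTneq rhs_fin => By.
  by rewrite /rhs By poweRyr ?gt_eqF// gt0_mulye ?poweR_gt0// ltxx.
have H_fin : (H < +oo)%E.
  rewrite ltey; apply: contraTneq rhs_fin => Hy.
  by rewrite /rhs Hy poweRyr ?gt_eqF// gt0_muley ?poweR_gt0// ltxx.
have [b Bb] : exists b, B = b%:E.
  by exists (fine B); rewrite fineK// ge0_fin_numE.
have b0 : 0 < b by rewrite -lte_fin -Bb.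
pose F k t := theta (2 ^- k * t).
pose low k := functional_calculus S (F k) u.
pose v k q := -1 * low k q + u q.
have mF k : cmeasurable (fun x => F k (sa S x)).
  have [/smooth_on_line_continuous cr /smooth_on_line_continuous ci _] :=
    theta_smooth.
  have m2a : measurable_fun setT (fun x => 2 ^- k * sa S x).
    by apply: measurable_funM => //; exact: sa_measurable.
  by split; [apply: (measurableT_comp (continuous_measurable_fun cr))|
    apply: (measurableT_comp (continuous_measurable_fun ci))].
have v_spec k := functional_calculus_complement (mF k)
  (fun t => thetaA (2 ^- k * t)) L2u.
have low_bound k : {ae vol, forall q,
    ComplexField.Normc.normc (low k q) <= b * (2 `^ sigma) ^+ k}.
  apply: Lpnormy_le_ae.
  have : ((2 `^ (- (k%:R * sigma)))%:E * Lpnorm vol +oo (low k) <= b%:E)%E.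
    by rewrite -Bb le_max ereal_sup_ubound//; exists k.
  rewrite powRN -lee_pdivlMl ?invr_gt0 ?powR_gt0// invrK -EFinM mulrC.
  by rewrite [k%:R * _]mulrC powRrM powR_mulrn ?powR_ge0.
have mU : measurable_fun setT (fun x => ComplexField.Normc.normc (sU S u x)).
  exact/measurable_normc/sU_cmeasurable.
have A0 : 0 <= A by exact: le_trans (normc_ge0 _) (thetaA 0).
have int_p : (\int[vol]_q (ComplexField.Normc.normc (u q) `^ p)%:E <=
    (C * b `^ (p - 2))%:E * H `^ 2)%E.
  rewrite sobolev_norm_sqr//.
  apply: (est _ _ vol _ _ nu b (fun q => ComplexField.Normc.normc (u q))
    (fun k q => ComplexField.Normc.normc (v k q)) (sa S)
    (fun x => ComplexField.Normc.normc (sU S u x))) => //.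
  - exact: measurable_normc.
  - by move=> q; exact: normc_ge0.
  - by move=> k; apply: measurable_normc; have [[]] := v_spec k.
  - exact: sa_measurable.
  - exact: sa_ge0.
  - move=> k.
    apply: (@filterS _ _ (ae_filter_ringOfSetsType vol) _ _ _ (low_bound k)).
    move=> q lowq.
    have -> : u q = low k q + v k q by rewrite /v mulN1r addrA subrr add0r.
    by apply: le_trans (normcD_le _ _) _; rewrite lerD2r.
  - move=> k; rewrite (v_spec k).2; apply: ge0_le_integral => //.
    + by move=> x _; rewrite lee_fin sqr_ge0.
    + apply/measurable_EFinP/measurable_funX/measurable_funM => //.
      exact/measurable_normc/cmeasurable_oneB.
    + apply/measurable_EFinP/measurable_funX/measurable_funM.
        apply: measurable_indicator_ge; apply: measurable_funM => //.
        exact: sa_measurable.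
      exact: measurable_funM.
    move=> x _; rewrite lee_fin mulrA.
    rewrite ler_sqr ?nnegrE; last 2 first.
    + by rewrite mulr_ge0 ?normc_ge0.
    + by rewrite !mulr_ge0 ?normc_ge0 ?addr_ge0.
    rewrite ler_wpM2r ?normc_ge0//.
    (* Either the indicator is 1 and the crude bound [1 + A] applies, or 2^-k a < [eps], where
       [theta] is 1 and the multiplier vanishes. *)
    have [le2k|lt2k] := leP (2 ^+ k) (sa S x / eps).
      rewrite mul1r; apply: le_trans (normcD_le _ _) _.
      rewrite normc_opp ComplexField.Normc.normc1 lerD2l; exact: thetaA.
    rewrite /F theta_eps ?subrr ?ComplexField.Normc.normc0 ?mul0r//=.
    rewrite sub0r normrN ger0_norm ?mulr_ge0 ?invr_ge0 ?exprn_ge0 ?sa_ge0//.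
    by rewrite mulrC ltr_pdivrMr ?exprn_gt0// mulrC -ltr_pdivrMr.
  - by rewrite -sU_sqr_isometry.
rewrite LpnormE.
(* Taking p-th roots yields the two exponents, as [(p - 2) / p = 1 - 2 / p]. *)
have -> : ((C `^ p^-1)%:E * rhs = ((C * b `^ (p - 2))%:E * H `^ 2) `^ p^-1)%E.
  rewrite poweRM ?poweR_ge0 ?lee_fin ?mulr_ge0 ?powR_ge0// -poweRrM.
  rewrite poweR_EFin powRM ?powR_ge0// -powRrM EFinM /rhs Bb poweR_EFin muleA.
  by rewrite mulrBl divff ?gt_eqF.
apply: gt0_ler_poweR; rewrite ?invr_ge0 ?(ltW p0)// ?in_itv/= ?leey ?andbT//.
- by apply: integral_ge0 => q _; rewrite lee_fin powR_ge0.
- by rewrite mule_ge0 ?poweR_ge0// lee_fin mulr_ge0 ?powR_ge0.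
Qed.
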